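(* Every finite bipartite series-parallel graph $G$ with bipartition classes $U,W$ satisfies Frankl's conjecture: if $G$ has at least one edge, then each of $U$ and $W$ contains a vertex belonging to at most half of the maximal stable sets of $G$.
   Context: A graph is series-parallel if it does not contain $K_4$ as a minor. A set of vertices is stable if no two are adjacent; maximal means maximal under inclusion. (Edgeless graphs are considered to satisfy Frankl's conjecture trivially.) *)

(* Defs.v *)
From mathcomp Require Import all_boot.

Set Implicit Arguments.
Unset Strict Implicit.
Unset Printing Implicit Defensive.

Definition simple_graph (T : finType) (e : rel T) : Prop :=
  symmetric e /\ irreflexive e.

Definition stable (T : finType) (e : rel T) (A : {set T}) : bool :=
  [forall x in A, forall y in A, ~~ e x y].

Definition max_stable_sets (T : finType) (e : rel T) : {set {set T}} :=
  [set A | maxset (stable e) A].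

Definition connected_in (T : finType) (e : rel T) (X : {set T}) : Prop :=
  X != set0 /\
  {in X &, forall x y, connect [rel u v | [&& u \in X, v \in X & e u v]] x y}.

(* B i is the branch set contracted to the vertex i of h. *)
Definition has_minor (T S : finType) (e : rel T) (h : rel S) : Prop :=
  exists B : S -> {set T},
    [/\ forall i, connected_in e (B i),
        forall i j, i != j -> [disjoint B i & B j]
      & forall i j, h i j -> exists x y, [/\ x \in B i, y \in B j & e x y]].

Definition complete_graph (n : nat) : rel 'I_n := [rel i j | i != j].
Arguments complete_graph n : clear implicits.

Definition series_parallel (T : finType) (e : rel T) : Prop :=
  ~ has_minor e (complete_graph 4).

Definition bipartition (T : finType) (e : rel T) (U W : {set T}) : Prop :=
  [/\ U :|: W = [set: T], [disjoint U & W], stable e U & stable e W].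

Definition in_at_most_half (T : finType) (e : rel T) (v : T) : Prop :=
  2 * #|[set A in max_stable_sets e | v \in A]| <= #|max_stable_sets e|.

Definition satisfies_Frankl (T : finType) (e : rel T) (U W : {set T}) : Prop :=
  (exists x y, e x y) ->
  (exists2 u, u \in U & in_at_most_half e u) /\
  (exists2 w, w \in W & in_at_most_half e w).

(* Main.v *)
(* A vertex of [U] in at most half of the maximal stable sets is sought. If [w] outside
   [U] has neighbours [y1], [y2] with N(N(w)) contained in N(y1) u N(y2), then a maximal
   stable set [A] containing both [y1] and [y2] contains N(w), hence can be recovered
   from the maximal stable set generated by [A :\: U] and [w], which contains neither.
   Counting shows that [y1] or [y2] lies in at most half of the maximal stable sets.

   Such a [w] exists: let [D] be a minimal subset of [U] such that every N(u) with [u]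
   in [U] is contained in N(d) for some [d] in [D]. It suffices that some non-isolated
   [w] outside [U] has at most two neighbours in [D]. Otherwise contract each vertex of
   [D] of degree 2 into one of its neighbours: since the neighbourhoods of [D] form an
   antichain, the result is a simple graph of minimum degree at least 3, and such a
   graph has a K4 minor. *)

Require Import Defs.
From mathcomp Require Import all_boot zify.

Set Implicit Arguments.
Unset Strict Implicit.
Unset Printing Implicit Defensive.

Section FiniteSets.

Variable T : finType.
Implicit Types (x y z : T) (A B D M P Q : {set T}) (r : rel T).

Lemma exists_notin_ltn_card A B :
  #|B| < #|A| -> exists2 x, x \in A & x \notin B.
Proof.
move=> ltBA; apply/subsetPn; apply: contraL ltBA => /subset_leq_card.
by rewrite -leqNgt.
Qed.

Lemma cards3_set3 A x y :
  #|A| = 3 -> x \in A -> y \in A -> x != y -> exists z, A = [set x; y; z].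
Proof.
move=> A3 xA yA xy; have yAx : y \in A :\ x by rewrite !inE eq_sym xy.
have /eqP/cards1P[z Axy] : #|A :\ x :\ y| = 1.
  by move: A3; rewrite (cardsD1 x) xA (cardsD1 y (A :\ x)) yAx; case.
by exists z; rewrite -setUA -Axy !setD1K.
Qed.

Lemma card_set3_neq x y z :
  2 < #|[set x; y; z]| -> [/\ x != y, x != z & y != z].
Proof.
have -> : #|[set x; y; z]| = #|[:: x; y; z]| by apply: eq_card => w; rewrite !inE orbA.
move=> gt2; have : uniq [:: x; y; z] by apply/card_uniqP/eqP; rewrite eqn_leq card_size.
by rewrite /= !inE negb_or andbT => /andP[/andP[xy xz] yz].
Qed.

Lemma card_le2_set2 A x : x \in A -> #|A| <= 2 -> exists y z, A = [set y; z].
Proof.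
move=> xA; rewrite leq_eqVlt ltnS => /orP[/cards2P[y [z [_ ->]]]|le1].
  by exists y, z.
have /cards1P[y ->] : #|A| == 1 by rewrite eqn_leq le1 card_gt0; apply/set0Pn; exists x.
by exists y, y; rewrite setUid.
Qed.

Lemma leq_half_card_or M P Q :
  P \subset M -> Q \subset M -> #|P :&: Q| <= #|M :\: (P :|: Q)| ->
  2 * #|P| <= #|M| \/ 2 * #|Q| <= #|M|.
Proof.
move=> PM QM leIC; have: #|P| + #|Q| <= #|M|; last by lia.
have PQM : M :&: (P :|: Q) = P :|: Q by apply/setIidPr; rewrite subUset PM.
by rewrite -cardsUI -(cardsID (P :|: Q) M) PQM leq_add2l.
Qed.

Lemma exists_cofinal_antichain r A :
  reflexive r -> transitive r ->
  exists D, [/\ D \subset A, {in A, forall u, exists2 d, d \in D & r u d}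
              & {in D &, forall u v, r u v -> u = v}].
Proof.
move=> r_refl r_trans.
pose cofinal D := (D \subset A) && [forall u in A, exists d in D, r u d].
have cofinalA : cofinal A.
  by rewrite /cofinal subxx; apply/forall_inP=> u uA; apply/exists_inP; exists u.
have [D /minsetP[/andP[DA /forall_inP coD] minD] _] := minset_exists cofinalA.
exists D; split=> // [u uA|u v uD vD ruv]; first exact/exists_inP/coD.
apply/eqP/negPn/negP=> neq_uv; suff /minD/(_ (subD1set D u)) DuD : cofinal (D :\ u).
  by move: uD; rewrite -DuD !inE eqxx.
rewrite /cofinal (subset_trans (subD1set D u) DA); apply/forall_inP=> s sA.
have /exists_inP[d dD rsd] := coD s sA; apply/exists_inP.
have [du|neq_du] := eqVneq d u; last by exists d; rewrite // !inE neq_du.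
by exists v; [rewrite !inE eq_sym neq_uv | apply: r_trans ruv; rewrite -du].
Qed.

End FiniteSets.

Section Graphs.

Variable T : finType.
Implicit Types (e h : rel T) (x y t v : T) (X Y : {set T}).

Definition nbhd e x : {set T} := [set y | e x y].

Lemma in_nbhd e x y : (y \in nbhd e x) = e x y.
Proof. by rewrite inE. Qed.

Definition edges e : {set T * T} := [set p | e p.1 p.2].

Definition induced e X : rel T := [rel x y | [&& x \in X, y \in X & e x y]].

Definition component e X t : {set T} := [set x | connect (induced e X) t x].

Definition adjacent e X Y : bool := [exists x in X, exists y in Y, e x y].

Lemma adjacentP e X Y :
  reflect (exists x y, [/\ x \in X, y \in Y & e x y]) (adjacent e X Y).
Proof.
apply: (iffP exists_inP) => [[x xX /exists_inP[y yY exy]]|[x [y [xX yY exy]]]].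
  by exists x, y.
by exists x => //; apply/exists_inP; exists y.
Qed.

Lemma edge_neq e x y : simple_graph e -> e x y -> x != y.
Proof. by case=> _ e_irr; apply: contraTneq => ->; rewrite e_irr. Qed.

Lemma induced_simple e X : simple_graph e -> simple_graph (induced e X).
Proof.
case=> e_sym e_irr; split=> [x y|x]; rewrite /induced /= ?e_irr ?andbF //.
by rewrite e_sym andbCA.
Qed.

Lemma connect_induced_sym e X : symmetric e -> connect_sym (induced e X).
Proof.
by move=> e_sym; apply: sym_connect_sym => x y; rewrite /induced /= e_sym andbCA.
Qed.

Lemma connect_inducedS e h X Y x y :
  subrel h e -> X \subset Y -> connect (induced h X) x y -> connect (induced e Y) x y.
Proof.
move=> he /subsetP XY; apply: connect_sub => u v /and3P[/XY uY /XY vY /he euv].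
by apply: connect1; rewrite /induced /= uY vY.
Qed.

Lemma connected_in_from e X v :
  symmetric e -> v \in X -> {in X, forall x, connect (induced e X) v x} ->
  connected_in e X.
Proof.
move=> e_sym vX vconn; split=> [|x y xX yX]; first by apply/set0Pn; exists v.
by apply: connect_trans (vconn y yX); rewrite connect_induced_sym ?vconn.
Qed.

Lemma connected_in_star e X v :
  symmetric e -> v \in X -> {in X, forall x, x != v -> e v x} -> connected_in e X.
Proof.
move=> e_sym vX star; apply: (connected_in_from e_sym vX) => x xX.
have [->|xv] := eqVneq x v; first exact: connect0.
by apply: connect1; rewrite /induced /= vX xX star.
Qed.

Lemma connected_in1 e x : symmetric e -> connected_in e [set x].
Proof.
move=> e_sym; apply: (connected_in_star e_sym (set11 x)) => y.
by rewrite inE => /eqP->; rewrite eqxx.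
Qed.

Lemma component_root e X t : t \in component e X t.
Proof. by rewrite inE connect0. Qed.

Lemma component_sub e X t : t \in X -> component e X t \subset X.
Proof.
move=> tX; apply/subsetP=> x; rewrite inE => /(closed_connect (a := mem X)) <- //.
by move=> u v /and3P[uX vX _]; rewrite uX vX.
Qed.

Lemma component_closed e X t x y :
  t \in X -> x \in component e X t -> y \in X -> e x y -> y \in component e X t.
Proof.
move=> tX xC yX exy; have xX := subsetP (component_sub e tX) x xC.
move: xC; rewrite !inE => /connect_trans; apply; apply: connect1.
by rewrite /induced /= xX yX.
Qed.

Lemma connected_in_component e X t :
  symmetric e -> t \in X -> connected_in e (component e X t).
Proof.
move=> e_sym tX; set C := component e X t.
have path_in s p :
    s \in C -> path (induced e X) s p -> connect (induced e C) s (last s p).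
  elim: p s => [|y p IHp] s sC /=; first by rewrite connect0.
  case/andP=> /and3P[_ yX esy] pathp; have yC : y \in C := component_closed tX sC yX esy.
  by apply: connect_trans (IHp y yC pathp); apply: connect1; rewrite /induced /= sC yC.
apply: (connected_in_from e_sym (component_root e X t)) => x.
by rewrite inE => /connectP[p pathp ->]; apply/path_in/pathp/component_root.
Qed.

Lemma card_edges_subrel e h x y :
  subrel h e -> e x y -> ~~ h x y -> #|edges h| < #|edges e|.
Proof.
move=> he exy hxy; apply/proper_card/properP; split; last by exists (x, y); rewrite inE.
by apply/subsetP=> p; rewrite !inE => /he.
Qed.

Lemma has_minor_subrel (S : finType) (k : rel S) e h :
  subrel h e -> has_minor h k -> has_minor e k.
Proof.
move=> he [B [connB disB adjB]]; exists B; split=> // [i|i j kij].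
  have [B0 connBi] := connB i; split=> // x y xB yB.
  exact: (connect_inducedS he (subxx _) (connBi x y xB yB)).
by have [x [y [xB yB /he exy]]] := adjB i j kij; exists x, y.
Qed.

Lemma has_complete_minor e (Bs : seq {set T}) :
  symmetric e -> {in Bs, forall X, connected_in e X} ->
  pairwise (fun X Y => [disjoint X & Y] && adjacent e X Y) Bs ->
  has_minor e (complete_graph (size Bs)).
Proof.
pose B i := nth set0 Bs i; move=> e_sym connBs /(pairwiseP set0) pairBs.
have pair_ltn (i j : 'I_(size Bs)) :
    i < j -> [disjoint B i & B j] && adjacent e (B i) (B j).
  by apply: pairBs; rewrite inE.
exists (fun i : 'I_(size Bs) => B i); split=> [i|i j|i j].
- exact/connBs/mem_nth.
- by rewrite -val_eqE neq_ltn => /orP[]/pair_ltn/andP[] //; rewrite disjoint_sym.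
rewrite /complete_graph /= -val_eqE neq_ltn.
case/orP=> /pair_ltn/andP[_ /adjacentP[x [y [xB yB exy]]]]; first by exists x, y.
by exists y, x; rewrite e_sym.
Qed.

End Graphs.

Section Contraction.

Variables (S T : finType) (f : T -> S).
Implicit Types (e : rel T) (x y : T) (u v : S).

Definition contraction e : rel S :=
  [rel u v | (u != v) && [exists x, exists y, [&& f x == u, f y == v & e x y]]].

Lemma contractionP e u v :
  reflect (u != v /\ exists x y, [/\ f x = u, f y = v & e x y]) (contraction e u v).
Proof.
apply: (iffP andP) => -[uv].
  by case/existsP=> x /existsP[y /and3P[/eqP xu /eqP yv exy]]; split=> //; exists x, y.
case=> x [y [xu yv exy]]; split=> //; apply/existsP; exists x; apply/existsP; exists y.
by rewrite xu yv !eqxx.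
Qed.

Lemma contraction_edge e x y : e x y -> f x != f y -> contraction e (f x) (f y).
Proof. by move=> exy fxy; apply/contractionP; split=> //; exists x, y. Qed.

Lemma contraction_simple e : symmetric e -> simple_graph (contraction e).
Proof.
move=> e_sym; split=> [u v|u]; last by rewrite /contraction /= eqxx.
by apply/contractionP/contractionP=> -[uv [x [y [xu yv exy]]]];
  split; rewrite 1?eq_sym //; exists y, x; rewrite e_sym.
Qed.

Lemma card_edges_contraction e x y :
  e x y -> f x = f y -> #|edges (contraction e)| < #|edges e|.
Proof.
move=> exy fxy; pose ff p := (f p.1, f p.2).
have xyE : (x, y) \in edges e by rewrite inE.
rewrite [ltnRHS](cardsD1 (x, y)) xyE ltnS.
apply: leq_trans (leq_imset_card ff _); apply/subset_leq_card/subsetP=> -[u v].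
rewrite inE /= => /contractionP[uv [x' [y' [xu yv exy']]]].
apply/imsetP; exists (x', y'); last by rewrite /ff /= xu yv.
rewrite !inE exy' andbT; apply: contraNneq uv => -[xx' yy'].
by rewrite -xu -yv xx' yy' fxy.
Qed.

Lemma connect_preimset_contraction e (X : {set S}) x y :
  (forall x y, f x = f y -> connect (induced e (f @^-1: [set f x])) x y) ->
  f x \in X -> connect (induced (contraction e) X) (f x) (f y) ->
  connect (induced e (f @^-1: X)) x y.
Proof.
move=> fibres fxX /connectP[p]; elim: p x fxX => [|u p IHp] x fxX /=.
  move=> _ /esym/fibres; apply: connect_inducedS => //.
  by apply: preimsetS; rewrite sub1set.
case/andP=> /and3P[_ uX /contractionP[_ [x' [y' [fx' fy' exy']]]]] pathp yE.
subst u; apply: connect_trans (IHp y' uX pathp yE).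
have x'X : x' \in f @^-1: X by rewrite inE fx'.
apply: (connect_trans (y := x')); last by apply: connect1; rewrite /induced /= x'X inE uX.
apply: connect_inducedS (fibres x x' (esym fx')) => //.
by apply: preimsetS; rewrite sub1set.
Qed.

(* A vertex outside the image of [f] is isolated in the contraction and has no branch
   set in [e], hence the condition on [k]. *)
Lemma has_minor_contraction (R : finType) (k : rel R) e :
  (forall i, exists j, k i j) ->
  (forall x y, f x = f y -> connect (induced e (f @^-1: [set f x])) x y) ->
  has_minor (contraction e) k -> has_minor e k.
Proof.
move=> k_nbr fibres [B [connB disB adjB]]; exists (fun i => f @^-1: B i).
have lift_edge i j : k i j ->
    exists x y, [/\ x \in f @^-1: B i, y \in f @^-1: B j & e x y].
  case/adjB=> u [v [uB vB /contractionP[_ [x [y [xu yv exy]]]]]].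
  by exists x, y; rewrite !inE xu yv.
split=> // [i|i j ij]; last first.
  by rewrite -setI_eq0 -preimsetI (disjoint_setI0 (disB i j ij)) preimset0.
split=> [|x y]; last first.
  rewrite !inE => xB yB; apply: connect_preimset_contraction => //.
  by case: (connB i) => _; apply.
by have [j /lift_edge[x [_ [xB _ _]]]] := k_nbr i; apply/set0Pn; exists x.
Qed.

End Contraction.

Lemma complete_graph_nbr n (i : 'I_n.+2) : exists j, complete_graph n.+2 i j.
Proof.
by exists (if i == ord0 then ord_max else ord0); case: (i =P ord0) => [->|/eqP].
Qed.

Section EdgeContraction.

Variable T : finType.
Implicit Types (e : rel T) (f : T -> T) (u v w x y : T).

Lemma has_minor_retraction (R : finType) (k : rel R) e f :
  (forall i, exists j, k i j) ->
  symmetric e -> (forall x, f (f x) = f x) -> (forall x, x != f x -> e (f x) x) ->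
  has_minor (contraction f e) k -> has_minor e k.
Proof.
move=> k_nbr e_sym f_idem f_edge; apply: has_minor_contraction => // x y fxy.
have [_] : connected_in e (f @^-1: [set f x]).
  apply: (connected_in_star (v := f x)) => //; first by rewrite !inE f_idem.
  by move=> z; rewrite !inE => /eqP <-; apply: f_edge.
by apply; rewrite !inE // fxy.
Qed.

Definition merge x y : T -> T := fun z => if z == y then x else z.

Lemma merge_id x y z : z != y -> merge x y z = z.
Proof. by rewrite /merge => /negbTE->. Qed.

Lemma merge_l x y : merge x y x = x.
Proof. by rewrite /merge; case: ifP. Qed.

Lemma merge_r x y : merge x y y = x.
Proof. by rewrite /merge eqxx. Qed.

Lemma has_minor_merge (R : finType) (k : rel R) e x y :
  (forall i, exists j, k i j) ->
  symmetric e -> e x y -> has_minor (contraction (merge x y) e) k -> has_minor e k.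
Proof.
move=> k_nbr e_sym exy; apply: has_minor_retraction => // z; rewrite /merge.
  by case: (z =P y) => [_|/eqP/negbTE->] //; case: ifP.
by case: (z =P y) => [->|]; rewrite ?eqxx.
Qed.

Lemma card_edges_merge e x y :
  e x y -> #|edges (contraction (merge x y) e)| < #|edges e|.
Proof.
move=> exy; apply: (card_edges_contraction exy).
by rewrite merge_l merge_r.
Qed.

Lemma contraction_merge_edge e x y w :
  e x w || e y w -> w != x -> w != y -> contraction (merge x y) e x w.
Proof.
move=> exyw wx wy; apply/contractionP; split; first by rewrite eq_sym.
by case/orP: exyw => ew; [exists x, w | exists y, w];
  split=> //; rewrite ?merge_l ?merge_r // merge_id.
Qed.

Lemma contraction_merge_origin e x y u v :
  contraction (merge x y) e u v -> u != x -> u != y /\ exists w, e u w.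
Proof.
case/contractionP=> _ [u' [w [<- _ eu'w]]]; rewrite /merge.
by case: ifP => [|u'y _]; rewrite ?eqxx // u'y; split=> //; exists w.
Qed.

Lemma leq_card_imset_merge x y (A : {set T}) :
  #|A| <= #|merge x y @: A| + ((x \in A) && (y \in A)).
Proof.
have inj_D1 : {in A :\ y &, injective (merge x y)}.
  by move=> u v /setD1P[uy _] /setD1P[vy _]; rewrite !merge_id.
have [xyA|] := boolP ((x \in A) && (y \in A)).
  rewrite addn1 (cardsD1 y) (andP xyA).2 ltnS -(card_in_imset inj_D1).
  exact/subset_leq_card/imsetS/subD1set.
rewrite negb_and addn0 => xyA; rewrite card_in_imset // => u v uA vA.
rewrite /merge; case: (u =P y) => [uy|_]; case: (v =P y) => [vy|_] //.
- by rewrite uy vy.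
- by move=> xv; rewrite xv vA -uy uA in xyA.
- by move=> ux; rewrite -ux uA -vy vA in xyA.
Qed.

Lemma card_nbhd_contraction_merge e x y u :
  irreflexive e -> u != x -> u != y ->
  #|nbhd e u| <= #|nbhd (contraction (merge x y) e) u| + (e u x && e u y).
Proof.
move=> e_irr ux uy; have := leq_card_imset_merge x y (nbhd e u); rewrite !inE.
move=> le_imset; apply: leq_trans le_imset _; rewrite leq_add2r.
apply/subset_leq_card/subsetP=> _ /imsetP[v euv ->]; rewrite !inE in euv *.
rewrite -[in X in contraction _ _ X](merge_id x uy) contraction_edge //.
rewrite (merge_id x uy) /merge; case: ifP => // _.
by apply: contraTneq euv => ->; rewrite e_irr.
Qed.

End EdgeContraction.

(* The root is exempt from the degree bound so that edges at it can be contracted.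
   Isolated vertices are ignored, so that subgraphs and contractions of a graph on [T]
   can be taken to be graphs on [T]. *)
Definition rooted_min_degree3 (T : finType) (e : rel T) (a : T) : Prop :=
  [/\ simple_graph e, exists x, e a x
    & forall x y, e x y -> x != a -> 2 < #|nbhd e x|].

Section RootedGraphs.

Variables (T : finType) (e : rel T) (a : T).
Hypothesis rooted : rooted_min_degree3 e a.

Let e_sym : symmetric e. Proof. by case: rooted => -[]. Qed.
Let e_irr : irreflexive e. Proof. by case: rooted => -[]. Qed.
Let deg3 x y : e x y -> x != a -> 2 < #|nbhd e x|.
Proof. by case: rooted => _ _; apply. Qed.

Let e_neq x y : e x y -> x != y.
Proof. by case: rooted => simple_e _ _; apply: edge_neq. Qed.

Lemma rooted_merge_root y :
  e a y -> (forall z, e a z -> e y z -> 3 < #|nbhd e z|) ->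
  rooted_min_degree3 (contraction (merge a y) e) a.
Proof.
move=> eay deg4; have ay := e_neq eay; have eya : e y a by rewrite e_sym.
split=> [||x v exv xa]; first exact: contraction_simple.
  have /exists_notin_ltn_card[w] : #|[set a]| < #|nbhd e y|.
    by rewrite cards1 ltnW // (deg3 eya) // eq_sym.
  rewrite !inE => eyw wa; exists w.
  by apply: contraction_merge_edge; rewrite ?eyw ?orbT // eq_sym e_neq.
have [xy [w exw]] := contraction_merge_origin exv xa.
have := card_nbhd_contraction_merge e_irr xa xy.
have [/andP[exa exy]|_] := boolP (e x a && e x y); last first.
  by rewrite addn0; apply: leq_trans (deg3 exw xa).
by rewrite addn1 => le_deg; rewrite -ltnS (leq_trans _ le_deg) // deg4 // e_sym.
Qed.

Lemma rooted_merge_or_cubic_triangle y : e a y ->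
  rooted_min_degree3 (contraction (merge a y) e) a \/
  exists z, [/\ e a z, e y z & #|nbhd e z| = 3].
Proof.
move=> eay; case: (boolP [exists z, [&& e a z, e y z & #|nbhd e z| <= 3]]).
  case/existsP=> z /and3P[eaz eyz le3]; right; exists z; split=> //.
  by apply/eqP; rewrite eqn_leq le3 (deg3 (y := a)) 1?e_sym // eq_sym e_neq.
rewrite negb_exists => /forallP deg4; left; apply: rooted_merge_root => // z eaz eyz.
by have := deg4 z; rewrite eaz eyz -ltnNge.
Qed.

Section AdjacentCubicVertices.

Variables z z' t t' : T.
Hypotheses (nbhd_z : nbhd e z = [set a; z'; t]) (nbhd_z' : nbhd e z' = [set a; z; t']).

Let eza : e z a. Proof. by have /setP/(_ a) := nbhd_z; rewrite !inE eqxx. Qed.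
Let ezz' : e z z'. Proof. by have /setP/(_ z') := nbhd_z; rewrite !inE eqxx orbT. Qed.
Let ezt : e z t. Proof. by have /setP/(_ t) := nbhd_z; rewrite !inE eqxx !orbT. Qed.
Let ez'a : e z' a. Proof. by have /setP/(_ a) := nbhd_z'; rewrite !inE eqxx. Qed.
Let ez't' : e z' t'. Proof. by have /setP/(_ t') := nbhd_z'; rewrite !inE eqxx !orbT. Qed.

Let neq_z : [/\ a != z', a != t & z' != t].
Proof. by apply: card_set3_neq; rewrite -nbhd_z (deg3 eza) ?e_neq. Qed.

Let neq_z' : [/\ a != z, a != t' & z != t'].
Proof. by apply: card_set3_neq; rewrite -nbhd_z' (deg3 ez'a) ?e_neq. Qed.

Lemma rooted_merge_cubic :
  t != t' -> rooted_min_degree3 (contraction (merge z z') e) a.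
Proof.
have [[neq_az' neq_at neq_z't] [neq_az neq_at' neq_zt']] := (neq_z, neq_z') => tt'.
split=> [||x v exv xa]; first exact: contraction_simple.
  exists z; have [-> _] := contraction_simple (merge z z') e_sym.
  by rewrite contraction_merge_edge ?eza.
have [->|xz] := eqVneq x z.
  apply/card_gt2P; exists a, t, t'; split; last by rewrite neq_at tt' eq_sym neq_at'.
  have [neq_tz neq_t'z'] : t != z /\ t' != z' by rewrite eq_sym e_neq // eq_sym e_neq.
  by rewrite !inE !contraction_merge_edge ?eza ?ezt ?ez't' ?orbT // eq_sym.
have [xz' [w exw]] := contraction_merge_origin exv xz.
have := card_nbhd_contraction_merge e_irr xz xz'.
suff /negbTE-> : ~~ (e x z && e x z') by rewrite addn0; apply: leq_trans (deg3 exw xa).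
apply/negP=> /andP[exz exz']; case/eqP: tt'.
have : x \in nbhd e z by rewrite inE e_sym.
rewrite nbhd_z !inE (negbTE xa) (negbTE xz') => /eqP <-.
have : x \in nbhd e z' by rewrite inE e_sym.
by rewrite nbhd_z' !inE (negbTE xa) (negbTE xz) => /eqP.
Qed.

Hypothesis tt' : t = t'.

Let X : {set T} := ~: [set a; z; z'].
Let D : {set T} := component e X t.

Let tX : t \in X.
Proof.
have [[_ neq_at neq_z't] [_ _ neq_zt']] := (neq_z, neq_z').
by rewrite !inE !negb_or ![t == _]eq_sym neq_at neq_z't tt' neq_zt'.
Qed.

Let D_neq x : x \in D -> [/\ x != a, x != z & x != z'].
Proof.
by move=> /(subsetP (component_sub e tX)); rewrite !inE !negb_or => /andP[/andP[]].
Qed.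

Let a_notin_D : a \notin D. Proof. by apply/negP=> /D_neq[]; rewrite eqxx. Qed.
Let z_notin_D : z \notin D. Proof. by apply/negP=> /D_neq[]; rewrite eqxx. Qed.
Let z'_notin_D : z' \notin D. Proof. by apply/negP=> /D_neq[]; rewrite eqxx. Qed.

Lemma K4_minor_of_root_adjacent_component x :
  x \in D -> e a x -> has_minor e (complete_graph 4).
Proof.
move=> xD eax; have [[neq_az' _ _] [neq_az _ _]] := (neq_z, neq_z').
apply: (@has_complete_minor _ _ [:: [set a]; [set z]; [set z']; D]) => // [Y|].
  rewrite !in_cons in_nil orbF => /or4P[]/eqP->; try exact: connected_in1.
  exact: connected_in_component.
have adj u v (B : {set T}) : e u v -> v \in B -> adjacent e [set u] B.
  by move=> euv vB; apply/adjacentP; exists u, v; rewrite set11.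
have [eaz eaz'] : e a z /\ e a z' by rewrite !(e_sym a).
have ez't : e z' t by rewrite tt'.
rewrite /= !disjoints1 !in_set1 (adj a z) 1?(adj a z') 1?(adj a x) ?set11 //=.
rewrite (adj z z') 1?(adj z t) 1?(adj z' t) ?set11 ?component_root //.
by rewrite neq_az neq_az' (e_neq ezz') a_notin_D z_notin_D z'_notin_D.
Qed.

Let D_closed x y : {in D, forall w, ~~ e a w} ->
  x \in D -> e x y -> y != z -> y != z' -> y \in D.
Proof.
move=> a_notadj xD exy yz yz'; apply: (component_closed tX xD) => //.
rewrite !inE !negb_or yz yz' !andbT; apply: contraNneq (a_notadj x xD) => <-.
by rewrite e_sym.
Qed.

Let D_notadj x : x \in D -> x != t -> ~~ e x z /\ ~~ e x z'.
Proof.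
move=> /D_neq[xa xz xz'] xt; rewrite ![e x _]e_sym -!in_nbhd nbhd_z nbhd_z' -tt' !inE.
by rewrite (negbTE xa) (negbTE xz) (negbTE xz') (negbTE xt).
Qed.

Lemma rooted_induced_component :
  {in D, forall x, ~~ e a x} -> rooted_min_degree3 (induced e D) t.
Proof.
move=> a_notadj; split=> [||x y /and3P[xD _ exy] xt].
- by apply: induced_simple; case: rooted.
- have /exists_notin_ltn_card[w] : #|[set z; z']| < #|nbhd e t|.
    apply: (@leq_ltn_trans 2); first by rewrite cards2; case: eqP.
    by apply: (deg3 (y := z)); [rewrite e_sym | rewrite eq_sym; case: neq_z].
  rewrite in_nbhd !inE negb_or => etw /andP[wz wz']; exists w.
  have tD : t \in D := component_root e X t.
  by rewrite /induced /= etw tD (D_closed a_notadj tD).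
have [[xa _ _] [exz exz']] := (D_neq xD, D_notadj xD xt).
apply: leq_trans (deg3 exy xa) _; apply/subset_leq_card/subsetP=> w.
rewrite !in_nbhd /induced /= xD => exw; rewrite exw andbT (D_closed a_notadj xD exw) //.
  by apply: contraNneq exz => <-.
by apply: contraNneq exz' => <-.
Qed.

Lemma card_edges_induced_component : #|edges (induced e D)| < #|edges e|.
Proof.
apply: card_edges_subrel eza _ => [u v /and3P[] //|].
by rewrite /induced /= (negbTE z_notin_D).
Qed.

End AdjacentCubicVertices.
End RootedGraphs.

(* Contracting an edge [a x] at the root fails only if [a], [x] and some [z] of degree 3
   form a triangle; applied to [x] and then to [z], this gives adjacent [z], [z'] with
   neighbourhoods [a, z', t] and [a, z, t']. If [t != t'], contract [z z']. If [t = t'],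
   the component of [t] avoiding [a, z, z'] either has a neighbour of [a], and forms a
   K4 with these three, or is a smaller instance with root [t]. *)
Lemma K4_minor_of_rooted_min_degree3 (T : finType) (e : rel T) (a : T) :
  rooted_min_degree3 e a -> has_minor e (complete_graph 4).
Proof.
have [n] := ubnP #|edges e|; elim: n e a => // n IHn e a /ltnSE len rooted.
have [simple_e [y eay] _] := rooted; have [e_sym _] := simple_e.
have minor_of_merge x z : e x z ->
    rooted_min_degree3 (contraction (merge x z) e) a -> has_minor e (complete_graph 4).
  move=> exz /IHn minor; apply: (has_minor_merge (@complete_graph_nbr 2) e_sym exz).
  by apply: minor; apply: leq_trans (card_edges_merge exz) len.
have [/(minor_of_merge _ _ eay)//|[z [eaz _ z3]]] :=
  rooted_merge_or_cubic_triangle rooted eay.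
have [/(minor_of_merge _ _ eaz)//|[z' [eaz' ezz' z'3]]] :=
  rooted_merge_or_cubic_triangle rooted eaz.
have [t nbhd_z] : exists t, nbhd e z = [set a; z'; t].
  by apply: cards3_set3; rewrite ?in_nbhd ?(edge_neq simple_e) // e_sym.
have [t' nbhd_z'] : exists t', nbhd e z' = [set a; z; t'].
  by apply: cards3_set3; rewrite ?in_nbhd ?(edge_neq simple_e) // e_sym.
have [tt'|tt'] := eqVneq t t'; last first.
  by apply: (minor_of_merge z z') => //; apply: (rooted_merge_cubic rooted) tt'.
pose D := component e (~: [set a; z; z']) t.
have [/exists_inP[x xD eax]|] := boolP [exists x in D, e a x].
  exact: (K4_minor_of_root_adjacent_component rooted nbhd_z nbhd_z' tt' xD eax).
rewrite negb_exists_in => /forall_inP a_notadj.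
apply: (@has_minor_subrel _ _ _ _ (induced e D)) => [u v /and3P[] //|].
apply: (IHn _ t); last exact: rooted_induced_component nbhd_z nbhd_z' tt' a_notadj.
exact: leq_trans (card_edges_induced_component rooted nbhd_z nbhd_z' tt') len.
Qed.

Lemma K4_minor_of_min_degree3 (T : finType) (e : rel T) (x y : T) :
  simple_graph e -> e x y -> (forall x y, e x y -> 2 < #|nbhd e x|) ->
  has_minor e (complete_graph 4).
Proof.
move=> simple_e exy deg3; apply: (@K4_minor_of_rooted_min_degree3 _ _ x).
by split=> // [|u v /deg3]; first by exists y.
Qed.

Definition bipartite_side (T : finType) (e : rel T) (U : {set T}) : Prop :=
  forall x y, e x y -> (y \in U) = (x \notin U).

Lemma bipartition_sides (T : finType) (e : rel T) (U W : {set T}) :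
  bipartition e U W -> bipartite_side e U /\ bipartite_side e W.
Proof.
case=> UW /pred0P disUW /forall_inP stU /forall_inP stW.
have WE x : (x \in W) = (x \notin U).
  have := disUW x; have : x \in U :|: W by rewrite UW inE.
  by rewrite !inE /=; case: (x \in U); case: (x \in W).
suff side x y : e x y -> (y \in U) = (x \notin U).
  by split=> // x y exy; rewrite !WE (side x y).
move=> exy; have [xU|] := boolP (x \in U).
  by apply/negbTE/negP=> yU; have /forall_inP/(_ y yU)/negP := stU x xU.
rewrite -WE => xW; apply/negPn/negP; rewrite -WE => yW.
by have /forall_inP/(_ y yW)/negP := stW x xW.
Qed.

Section SuppressDegree2.

Variables (T : finType) (e : rel T) (D : {set T}).
Hypotheses (simple_e : simple_graph e) (side_D : bipartite_side e D).

Let e_sym : symmetric e. Proof. by case: simple_e. Qed.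

Let e_neq x y : e x y -> x != y. Proof. exact: edge_neq. Qed.

Definition suppressible (u : T) : bool := (u \in D) && (#|nbhd e u| == 2).

Definition suppress (u : T) : T :=
  if suppressible u then odflt u [pick x in nbhd e u] else u.

(* The neighbour of [v] reached through [u] once the vertices of degree 2 in [D] are
   suppressed. *)
Definition across (v u : T) : T :=
  if suppressible u then odflt u [pick x in nbhd e u :\ v] else u.

Lemma suppress_id u : ~~ suppressible u -> suppress u = u.
Proof. by rewrite /suppress => /negbTE->. Qed.

Lemma suppressible_in u : suppressible u -> u \in D.
Proof. by case/andP. Qed.

Lemma suppress_notin u : u \notin D -> suppress u = u.
Proof. by move=> uD; rewrite suppress_id // /suppressible (negbTE uD). Qed.

Lemma suppress_edge u : suppressible u -> e u (suppress u).
Proof.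
move=> supp_u; rewrite /suppress supp_u; case: pickP => [x|nbhd0] /=.
  by rewrite inE.
by case/andP: supp_u => _; rewrite eq_card0.
Qed.

Lemma suppress_idem u : suppress (suppress u) = suppress u.
Proof.
have [supp_u|nsupp_u] := boolP (suppressible u); last by rewrite !suppress_id.
by rewrite suppress_notin // (side_D (suppress_edge supp_u)) negbK suppressible_in.
Qed.

Lemma across_setD1 v u : suppressible u -> e v u -> nbhd e u :\ v = [set across v u].
Proof.
move=> supp_u evu; rewrite /across supp_u; case/andP: supp_u => _.
rewrite (cardsD1 v) in_nbhd e_sym evu => /cards1P[w nbhd_uv]; rewrite nbhd_uv.
by case: pickP => [x|/(_ w)]; rewrite inE ?eqxx // => /eqP->.
Qed.

Lemma across_in v u : e v u -> v \notin D -> (across v u \in D) = ~~ suppressible u.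
Proof.
move=> evu vD; have [supp_u|nsupp_u] := boolP (suppressible u); last first.
  by rewrite /across (negbTE nsupp_u) (side_D evu).
have /setP/(_ (across v u)) := across_setD1 supp_u evu.
by rewrite !inE eqxx => /andP[_ /side_D->]; rewrite suppressible_in.
Qed.

Lemma contraction_suppress_across v u :
  e v u -> v \notin D -> contraction suppress e v (across v u).
Proof.
move=> evu vD; have [supp_u|nsupp_u] := boolP (suppressible u); last first.
  rewrite /across (negbTE nsupp_u) -(suppress_notin vD).
  rewrite -[in X in _ X](suppress_id nsupp_u).
  by rewrite contraction_edge // suppress_notin // suppress_id // e_neq.
have /setP/(_ (suppress u)) := across_setD1 supp_u evu.
have /setP/(_ (across v u)) := across_setD1 supp_u evu.
rewrite !inE eqxx suppress_edge // andbT => /andP[av eua].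
have aD : across v u \notin D by rewrite across_in // supp_u.
move=> sup_u; apply/contractionP; split; first by rewrite eq_sym.
have [sv|sv] := eqVneq (suppress u) v.
  by exists u, (across v u); rewrite sv suppress_notin.
exists v, u; rewrite suppress_notin //; split=> //.
by apply/eqP; rewrite -sup_u.
Qed.

Hypothesis antichain_D : {in D &, forall u v, nbhd e u \subset nbhd e v -> u = v}.

Lemma across_inj v : v \notin D -> {in nbhd e v &, injective (across v)}.
Proof.
move=> vD u u'; rewrite !in_nbhd => evu evu' eq_across.
have := across_in evu' vD; rewrite -eq_across across_in // => /negb_inj supp_uu'.
have [supp_u|/negbTE nsupp_u] := boolP (suppressible u); last first.
  by move: eq_across; rewrite /across -supp_uu' nsupp_u.
have supp_u' : suppressible u' by rewrite -supp_uu'.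
apply: antichain_D; rewrite ?suppressible_in //.
rewrite -(setD1K (a := v) (A := nbhd e u)) ?in_nbhd 1?e_sym //.
rewrite -(setD1K (a := v) (A := nbhd e u')) ?in_nbhd 1?e_sym //.
by rewrite !across_setD1 // eq_across.
Qed.

Hypothesis deg3 : forall w u, w \notin D -> e w u -> 2 < #|nbhd e w|.

Lemma antichain_degree_gt1 u w : u \in D -> e u w -> 1 < #|nbhd e u|.
Proof.
move=> uD euw; have wD : w \notin D by rewrite (side_D euw) uD.
rewrite ltnNge; apply/negP=> /card_le1P/(_ w); rewrite in_nbhd => /(_ euw) nbhd_u.
have /exists_notin_ltn_card[v] : #|[set u]| < #|nbhd e w|.
  by rewrite cards1 ltnW // (deg3 wD (u := u)) // e_sym.
rewrite in_nbhd inE => ewv /eqP; apply; apply/esym/antichain_D => //.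
  by rewrite (side_D ewv).
by apply/subsetP=> x; rewrite nbhd_u inE => /eqP->; rewrite in_nbhd e_sym.
Qed.

Lemma contraction_suppress_degree v x :
  contraction suppress e v x -> 2 < #|nbhd (contraction suppress e) v|.
Proof.
case/contractionP=> _ [p [q [pv _ epq]]].
have v_fixed : suppress v = v by rewrite -pv suppress_idem.
have [w evw] : exists w, e v w.
  have [supp_p|/suppress_id p_fixed] := boolP (suppressible p).
    by exists p; rewrite e_sym -pv suppress_edge.
  by exists q; rewrite -pv p_fixed.
have [vD|vD] := boolP (v \in D); last first.
  apply: leq_trans (deg3 vD evw) _; rewrite -(card_in_imset (across_inj vD)).
  apply/subset_leq_card/subsetP=> _ /imsetP[u uv ->]; rewrite !in_nbhd in uv *.
  exact: contraction_suppress_across.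
have nsupp_v : ~~ suppressible v.
  by apply/negP=> /suppress_edge/e_neq; rewrite v_fixed eqxx.
have gt2_v : 2 < #|nbhd e v|.
  rewrite ltn_neqAle (antichain_degree_gt1 vD evw) andbT eq_sym.
  by move: nsupp_v; rewrite /suppressible vD.
apply: leq_trans gt2_v _; apply/subset_leq_card/subsetP=> u; rewrite !in_nbhd => evu.
have uD : u \notin D by rewrite (side_D evu) vD.
rewrite -v_fixed -(suppress_notin uD) contraction_edge // v_fixed suppress_notin //.
exact: e_neq.
Qed.

Lemma K4_minor_of_antichain x y : e x y -> has_minor e (complete_graph 4).
Proof.
move=> exy; wlog xD : x y exy / x \notin D => [suff_notin|].
  have [xD|xD] := boolP (x \in D); last exact: suff_notin exy xD.
  by apply: (suff_notin y x); rewrite ?(side_D exy) ?xD // e_sym.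
apply: (has_minor_retraction (@complete_graph_nbr 2) e_sym suppress_idem) => [u u_moved|].
  rewrite e_sym suppress_edge //; apply: contraR u_moved => /suppress_id->.
  by rewrite eqxx.
have h_edge := contraction_suppress_across exy xD.
apply: (K4_minor_of_min_degree3 _ h_edge); first exact: contraction_simple.
exact: contraction_suppress_degree.
Qed.

End SuppressDegree2.

Section MaximalStableSets.

Variables (T : finType) (e : rel T) (U : {set T}).
Hypotheses (simple_e : simple_graph e) (side_U : bipartite_side e U).
Implicit Types (A L : {set T}) (u w x y : T).

Let e_sym : symmetric e. Proof. by case: simple_e. Qed.

Lemma disjoint_nbhdP x A : reflect {in A, forall y, ~~ e x y} [disjoint nbhd e x & A].
Proof.
apply: (iffP pred0P) => [disA y yA|nadj y].
  by have := disA y; rewrite /= in_nbhd yA andbT => ->.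
by rewrite /= in_nbhd andbC; case: (boolP (y \in A)) => //= /nadj/negbTE.
Qed.

Lemma max_stableP A :
  reflect (forall x, (x \in A) = [disjoint nbhd e x & A]) (A \in max_stable_sets e).
Proof.
have [_ e_irr] := simple_e; rewrite inE; apply: (iffP maxsetP).
  case=> /forall_inP stA maxA x; apply/idP/disjoint_nbhdP => [xA y yA|nadj].
    by have /forall_inP/(_ y yA) := stA x xA.
  have /maxA : stable e (x |: A).
    apply/forall_inP=> y /setU1P[->|yA]; apply/forall_inP=> z /setU1P[->|zA].
    - by rewrite e_irr.
    - exact: nadj.
    - by rewrite e_sym nadj.
    - by have /forall_inP/(_ z zA) := stA y yA.
  by move=> <-; rewrite ?subsetU1 ?setU11.
move=> AE; split=> [|B /forall_inP stB /subsetP AB].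
  by apply/forall_inP=> x; rewrite AE => /disjoint_nbhdP nadj; apply/forall_inP.
apply/eqP; rewrite eqEsubset; apply/andP; split; apply/subsetP=> // x xB.
by rewrite AE; apply/disjoint_nbhdP=> y /AB yB; have /forall_inP/(_ y yB) := stB x xB.
Qed.

Definition stable_closure L : {set T} :=
  L :|: [set x in ~: U | [disjoint nbhd e x & L]].

Lemma stable_closure_side L x :
  L \subset U -> x \in U -> (x \in stable_closure L) = (x \in L).
Proof. by move=> LU xU; rewrite !inE xU orbF. Qed.

Lemma stable_closure_coside L x :
  L \subset U -> x \notin U -> (x \in stable_closure L) = [disjoint nbhd e x & L].
Proof.
move=> /subsetP LU xU; have /negbTE xL : x \notin L by apply: contra xU; apply: LU.
by rewrite !inE xU xL.
Qed.

Lemma disjoint_nbhd_side A x :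
  x \notin U -> [disjoint nbhd e x & A] = [disjoint nbhd e x & A :&: U].
Proof.
move=> xU; apply/disjoint_nbhdP/disjoint_nbhdP => nadj y yA.
  by apply: nadj; case/setIP: yA.
apply/negP=> exy; have /nadj : y \in A :&: U by rewrite inE yA (side_U exy).
by rewrite exy.
Qed.

Lemma stable_closureI A :
  A \in max_stable_sets e -> stable_closure (A :&: U) = A.
Proof.
move=> /max_stableP AE; apply/setP=> x; have [xU|xU] := boolP (x \in U).
  by rewrite stable_closure_side ?subsetIr // inE xU andbT.
by rewrite stable_closure_coside ?subsetIr // -disjoint_nbhd_side // -AE.
Qed.

Lemma stable_closure_max L :
  L \subset U ->
  {in U :\: L, forall x, exists2 y, e x y & [disjoint nbhd e y & L]} ->
  stable_closure L \in max_stable_sets e.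
Proof.
move=> LU blocked; apply/max_stableP=> x; have [xU|xU] := boolP (x \in U); last first.
  suff CU : stable_closure L :&: U = L.
    by rewrite stable_closure_coside // [RHS]disjoint_nbhd_side // CU.
  apply/setP=> y; rewrite in_setI; have [yU|yU] := boolP (y \in U).
    by rewrite andbT stable_closure_side.
  by rewrite andbF; apply/esym; apply: contraNF yU => /(subsetP LU).
rewrite stable_closure_side //; apply/idP/disjoint_nbhdP => [xL y yC|nadj].
  apply/negP=> exy; have yU : y \notin U by rewrite (side_U exy) xU.
  move: yC; rewrite stable_closure_coside // => /disjoint_nbhdP/(_ x xL).
  by rewrite e_sym exy.
apply/negPn/negP=> xL; have [|y exy disyL] := blocked x; first by rewrite inE xL.
have yU : y \notin U by rewrite (side_U exy) xU.
have /nadj : y \in stable_closure L by rewrite stable_closure_coside.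
by rewrite exy.
Qed.

Definition push_stable w A : {set T} := stable_closure (A :&: U :\: nbhd e w).

Let pushed_sub w A : A :&: U :\: nbhd e w \subset U.
Proof. exact/(subset_trans (subsetDl _ _))/subsetIr. Qed.

Lemma push_stable_side w A x :
  x \in U -> (x \in push_stable w A) = (x \in A) && ~~ e w x.
Proof. by move=> xU; rewrite stable_closure_side ?pushed_sub // !inE xU andbT andbC. Qed.

Lemma push_stable_max w A :
  w \notin U -> A \in max_stable_sets e -> push_stable w A \in max_stable_sets e.
Proof.
move=> wU /max_stableP AE; apply: stable_closure_max (pushed_sub w A) _ => x.
rewrite !inE !negb_and negbK => /andP[xL xU]; move: xL; rewrite xU orbF.
case/orP=> [ewx|]; first exists w; rewrite 1?e_sym //.
  by apply/disjoint_nbhdP=> y; rewrite !inE => /andP[].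
rewrite AE => /pred0Pn[y /andP[/=]]; rewrite in_nbhd => exy; rewrite AE => disyA.
exists y => //; apply: disjointWr disyA.
by apply: subset_trans (subsetDl _ _) _; apply: subsetIl.
Qed.

Lemma push_stable_inj w (F : {set {set T}}) :
  F \subset max_stable_sets e ->
  {in F, forall A, nbhd e w \subset A} -> {in F &, injective (push_stable w)}.
Proof.
move=> /subsetP Fmax NF A B AF BF AB.
rewrite -(stable_closureI (Fmax A AF)) -(stable_closureI (Fmax B BF)).
congr stable_closure; apply/setP=> x; rewrite !in_setI.
have [xU|] := boolP (x \in U); rewrite ?andbF ?andbT //.
have := push_stable_side w A xU; rewrite AB push_stable_side //.
have [ewx _|] := boolP (e w x); last by rewrite !andbT.
have xw : x \in nbhd e w by rewrite in_nbhd.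
by rewrite (subsetP (NF A AF) x xw) (subsetP (NF B BF) x xw).
Qed.

Lemma in_at_most_half_of_cover w y1 y2 :
  w \notin U -> e w y1 -> e w y2 ->
  {in nbhd e w, forall u, nbhd e u \subset nbhd e y1 :|: nbhd e y2} ->
  in_at_most_half e y1 \/ in_at_most_half e y2.
Proof.
move=> wU ewy1 ewy2 cover; set M := max_stable_sets e.
apply: leq_half_card_or; try by apply/subsetP=> A /setIdP[].
set both := _ :&: _.
have both_max : both \subset M by apply/subsetP=> A /setIP[/setIdP[]].
have nbhd_both : {in both, forall A, nbhd e w \subset A}.
  move=> A /setIP[/setIdP[/max_stableP AE y1A] /setIdP[_ y2A]].
  apply/subsetP=> u uw; rewrite AE; apply: disjointWl (cover u uw) _.
  by rewrite -setI_eq0 setIUl setU_eq0 !setI_eq0 -!AE y1A.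
rewrite -(card_in_imset (push_stable_inj both_max nbhd_both)).
apply/subset_leq_card/subsetP=> _ /imsetP[A Aboth ->].
have pushed_out y : e w y -> push_stable w A \notin [set B in M | y \in B].
  move=> ewy; apply/setIdP=> -[_]; rewrite push_stable_side ?(side_U ewy) //.
  by rewrite ewy andbF.
by rewrite in_setD in_setU negb_or !pushed_out // push_stable_max // (subsetP both_max).
Qed.

End MaximalStableSets.

Section SeriesParallel.

Variables (T : finType) (e : rel T) (U : {set T}).
Hypotheses (simple_e : simple_graph e) (side_U : bipartite_side e U).
Hypotheses (sp_e : series_parallel e) (edge_e : exists x y, e x y).

Let e_sym : symmetric e. Proof. by case: simple_e. Qed.

Let exists_edge_from_coside : exists w y, w \notin U /\ e w y.
Proof.
have [x [y exy]] := edge_e; have [xU|xU] := boolP (x \in U); last by exists x, y.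
by exists y, x; rewrite (side_U exy) xU e_sym.
Qed.

Lemma exists_degree_le2_into_antichain (D : {set T}) :
  D \subset U -> {in D &, forall u v, nbhd e u \subset nbhd e v -> u = v} ->
  exists w y, [/\ w \notin U, e w y & #|nbhd e w :&: D| <= 2].
Proof.
move=> /subsetP DU antichain_D.
have [/existsP[w /existsP[y /and3P[wU ewy le2]]]|] :=
  boolP [exists w, exists y, [&& w \notin U, e w y & #|nbhd e w :&: D| <= 2]].
  by exists w, y.
rewrite negb_exists => /forallP none; case: sp_e.
have gt2 w y : w \notin U -> e w y -> 2 < #|nbhd e w :&: D|.
  by move=> wU ewy; move/(_ w)/existsPn/(_ y): none; rewrite wU ewy -ltnNge.
pose S := D :|: ~: U; pose h := induced e S.
have he : subrel h e by move=> x y /and3P[].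
have D_eqU x : x \in S -> (x \in D) = (x \in U).
  case/setUP=> [xD|]; first by rewrite xD DU.
  by rewrite inE => xU; rewrite (contraNF (DU x)) // (negbTE xU).
have nbhd_D x : x \in D -> nbhd h x = nbhd e x.
  move=> xD; apply/setP=> y; rewrite !in_nbhd /h /induced /= !inE xD.
  by case: (boolP (e x y)) => [/side_U->|]; rewrite ?andbF // DU ?orbT.
have nbhd_coU w : w \notin U -> nbhd h w = nbhd e w :&: D.
  move=> wU; apply/setP=> y; rewrite in_setI !in_nbhd /h /induced /= !inE wU orbT /=.
  by case: (boolP (e w y)) => [/side_U->|]; rewrite ?andbF // wU orbF andbT.
apply: (has_minor_subrel he); have [w [y [wU ewy]]] := exists_edge_from_coside.
have /ltnW/ltnW/card_gt0P[u] := gt2 w y wU ewy; rewrite -nbhd_coU // in_nbhd => hwu.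
apply: (K4_minor_of_antichain (D := D)) hwu; first exact: induced_simple.
- by move=> x z /and3P[xS zS exz]; rewrite !D_eqU // (side_U exz).
- by move=> x z xD zD; rewrite !nbhd_D //; apply: antichain_D.
move=> x z xD /and3P[xS _ exz]; rewrite D_eqU // in xD.
by rewrite nbhd_coU //; apply: gt2 exz.
Qed.

Lemma exists_in_at_most_half : exists2 u, u \in U & in_at_most_half e u.
Proof.
have [||D [DU dominating antichain_D]] :=
  @exists_cofinal_antichain _ [rel u v | nbhd e u \subset nbhd e v] U.
- by move=> u /=.
- by move=> v u w /=; apply: subset_trans.
have [w [u [wU ewu le2]]] := exists_degree_le2_into_antichain DU antichain_D.
have dominated v : e w v -> exists2 d, d \in nbhd e w :&: D & nbhd e v \subset nbhd e d.
  move=> ewv; have [|d dD vd] := dominating v; first by rewrite (side_U ewv).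
  exists d => //; rewrite inE dD andbT in_nbhd e_sym.
  by have /subsetP/(_ w) := vd; rewrite !in_nbhd e_sym; apply.
have [d dwD _] := dominated u ewu.
have [y1 [y2 wD]] := card_le2_set2 dwD le2.
have : y1 \in nbhd e w :&: D /\ y2 \in nbhd e w :&: D by rewrite wD !inE !eqxx orbT.
case=> /setIP[]; rewrite in_nbhd => ewy1 y1D /setIP[]; rewrite in_nbhd => ewy2 y2D.
have [v|rare|rare] := in_at_most_half_of_cover simple_e side_U wU ewy1 ewy2.
- rewrite in_nbhd => /dominated[y]; rewrite wD => /set2P[]-> /subset_trans; apply.
    exact: subsetUl.
  exact: subsetUr.
- by exists y1; first exact: (subsetP DU).
- by exists y2; first exact: (subsetP DU).
Qed.

End SeriesParallel.

Theorem theorem17 (T : finType) (e : rel T) (U W : {set T}) :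
  simple_graph e ->
  bipartition e U W ->
  series_parallel e ->
  satisfies_Frankl e U W.
Proof.
move=> simple_e /bipartition_sides[side_U side_W] sp_e edge_e.
by split; apply: exists_in_at_most_half.
Qed.
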